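(* The complete graph $K_7$ satisfies $\operatorname{area}(K_7)=56$ and $\operatorname{perim}(K_7)=30$.
   Context: An integer rectangle is a set $[x_1,x_2]\times[y_1,y_2]$ with $x_1<x_2$, $y_1<y_2$ integers. Let $S$ be a finite set of integer rectangles with pairwise disjoint interiors (rectangles may share boundary edges). Two rectangles $A,B\in S$ see each other if there is a vertical or horizontal line segment that intersects the interiors of both $A$ and $B$ and intersects no other (closed) rectangle of $S$. $S$ is an RV-representation of a graph $G$ if the vertices of $G$ correspond bijectively to the rectangles of $S$ so that two vertices are adjacent if and only if their rectangles see each other. The bounding box of $S$ is the smallest axis-parallel rectangle containing all rectangles of $S$. $\operatorname{area}(G)$ and $\operatorname{perim}(G)$ (the perimeter of $G$) are the minimum area and minimum perimeter, respectively, of the bounding box, each minimum being taken separately over all RV-representations of $G$. *)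

(* Defs.v *)
From HB Require Import structures.
From mathcomp Require Import all_boot all_order all_algebra.
From mathcomp Require Import finmap.
From mathcomp Require Import mathcomp_extra boolp classical_sets set_interval reals.
From mathcomp Require Import topology normedtype.
Set Implicit Arguments.
Unset Strict Implicit.
Unset Printing Implicit Defensive.
Import Order.TTheory GRing.Theory Num.Theory.
Import numFieldNormedType.Exports.
Local Open Scope classical_set_scope.
Local Open Scope ring_scope.

Record sgraph := SGraph {
  vertex :> finType;
  adj : rel vertex;
  adj_sym : symmetric adj;
  adj_irrefl : irreflexive adj }.

Lemma complete_sym n : symmetric (fun u v : 'I_n => u != v).
Proof. by move=> u v; rewrite eq_sym. Qed.

Lemma complete_irrefl n : irreflexive (fun u v : 'I_n => u != v).
Proof. by move=> u; rewrite eqxx. Qed.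

Definition complete_graph (n : nat) : sgraph :=
  SGraph (@complete_sym n) (@complete_irrefl n).

(* The integer rectangle [x1, x2] x [y1, y2] is encoded as ((x1, x2), (y1, y2)). *)
Definition is_rect (p : (int * int) * (int * int)) : bool :=
  (p.1.1 < p.1.2) && (p.2.1 < p.2.2).

Definition rect := {p : (int * int) * (int * int) | is_rect p}.

Definition rect_width (A : rect) : int := (val A).1.2 - (val A).1.1.
Definition rect_height (A : rect) : int := (val A).2.2 - (val A).2.1.
Definition rect_area (A : rect) : int := rect_width A * rect_height A.
Definition rect_perim (A : rect) : int := 2 * (rect_width A + rect_height A).

Definition box (R : realType) (a b c d : R) : set (R * R) :=
  `[a, b] `*` `[c, d].

Definition rect_set (R : realType) (A : rect) : set (R * R) :=
  box (val A).1.1%:~R (val A).1.2%:~R (val A).2.1%:~R (val A).2.2%:~R.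

Arguments rect_set R A : clear implicits.

Definition hv_segment (R : realType) (s : set (R * R)) : Prop :=
  (exists a b y : R, a < b /\ s = box a b y y) \/
  (exists x c d : R, c < d /\ s = box x x c d).

Definition disjoint_interiors (R : realType) (S : {fset rect}) : Prop :=
  forall A B : rect, A \in S -> B \in S -> A != B ->
    interior (rect_set R A) `&` interior (rect_set R B) = set0.

Definition sees (R : realType) (S : {fset rect}) (A B : rect) : Prop :=
  exists s : set (R * R),
    [/\ hv_segment s,
        s `&` interior (rect_set R A) !=set0,
        s `&` interior (rect_set R B) !=set0
      & forall C : rect, C \in S -> C != A -> C != B ->
          s `&` rect_set R C = set0].

Definition RV_representation (R : realType) (G : sgraph) (S : {fset rect}) : Prop :=
  disjoint_interiors R S /\
  exists f : G -> S, bijective f /\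
    forall u v : G, u != v -> adj u v <-> sees R S (val (f u)) (val (f v)).

(* The competing rectangles have arbitrary real corners; when S is nonempty the
   least one has integer corners, so B itself can be taken of type rect. *)
Definition bounding_box (R : realType) (S : {fset rect}) (B : rect) : Prop :=
  (forall A : rect, A \in S -> rect_set R A `<=` rect_set R B) /\
  (forall a b c d : R,
     (forall A : rect, A \in S -> rect_set R A `<=` box a b c d) ->
     rect_set R B `<=` box a b c d).

Definition is_min (E : set int) (m : int) : Prop := E m /\ lbound E m.

Definition is_area (R : realType) (G : sgraph) : int -> Prop :=
  is_min [set rect_area B | B in
    [set B | exists S, RV_representation R G S /\ bounding_box R S B]].

Definition is_perim (R : realType) (G : sgraph) : int -> Prop :=
  is_min [set rect_perim B | B in
    [set B | exists S, RV_representation R G S /\ bounding_box R S B]].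

(* Main.v *)
Require Import Defs.
From mathcomp Require Import all_boot all_order all_algebra reals.
From mathcomp Require Import finmap classical_sets.
From mathcomp Require Import topology normedtype zify lra.
Set Implicit Arguments.
Unset Strict Implicit.
Unset Printing Implicit Defensive.
Import Order.TTheory GRing.Theory Num.Theory.
Import numFieldNormedType.Exports.
Local Open Scope classical_set_scope.
Local Open Scope ring_scope.

(** Cut the plane into unit columns and unit rows.  Two rectangles with integer
corners see each other horizontally exactly when some unit row meets both of
them and no rectangle that meets this row lies between them; vertically, the
same holds with columns ([sees_sight], [sight_sees]).  So the problem is about
intervals of integers.

Disjoint rectangles overlap in at most one of their two projections, and
rectangles that see each other overlap in at least one.  When all pairs see
each other, overlapping in the second projection is therefore the complement
of overlapping in the first ([one_overlap]).  A graph which is an interval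
graph together with its complement splits into a clique and an independent
set: here, some column [p] meets a family of rectangles and the remaining ones
are pairwise disjoint in the first projection ([split_column]); the latter
share a row [t].  At most four rectangles that all see each other can be
stacked through one column ([stack_lt5]), so of seven rectangles, up to
exchanging the axes, four rectangles [b1], ..., [b4] are stacked through [p]
and three rectangles [c1], [c2], [c3] stand side by side across [t]
([crossing]).

The bounds come from counting.  The number of columns is at least the sum of
the widths of the [c]'s plus the number of columns that avoid all the [c]'s.
No [c] overlaps all four [b]'s in the first projection ([overlaps_some]), so
[p] is a column of the second kind.  Most of the columns in which [b1] sees
[b3], [b1] sees [b4] and [b2] sees [b4] are of this kind too, and where one of
them is not, some [c] has to be wide; this gives at least 7 columns, and with
exactly 7 columns both [b2] and [b3] must overlap every [c] in the second
projection ([columns_needed]).  In the same way, the number of rows is at least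
the sum of the heights of the [b]'s plus the number of rows that avoid them.
It is at least 7 by [overlaps_some], and at least 8 when [b2] and [b3] overlap
every [c] in the second projection ([rows_needed]).  Hence the width [w] and
the height [h] of the bounding box satisfy [w, h >= 7] and [w + h >= 15]
([layout_size]), which gives the perimeter 30 and the area 56.  Both are
attained by one explicit arrangement in a box of width 7 and height 8. *)

(** * Intervals of integers *)

(** The pair [(m, n)] stands for the real interval from [m] to [n], that is, for
the unit cells [m], ..., [n - 1], where the cell [z] is the interval from [z]
to [z + 1]. *)
Definition ivl := (int * int)%type.
Definition cell (z : int) (I : ivl) : bool := I.1 <= z < I.2.
Definition before (I J : ivl) : bool := I.2 <= J.1.
Definition overlap (I J : ivl) : bool := (I.1 < J.2) && (J.1 < I.2).
Definition between (I K J : ivl) : bool :=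
  before I K && before K J || before J K && before K I.
Definition flip (I : ivl) : ivl := (- I.2, - I.1).

(* Between is unfolded first, since its body mentions before. *)
Ltac unfold_ivl := unfold cell, between, before, overlap in *.

Lemma between_flip I K J : between (flip I) (flip K) (flip J) = between I K J.
Proof. by rewrite /between /before /flip /=; lia. Qed.

Lemma before_flip I J : before (flip I) (flip J) = before J I.
Proof. by rewrite /before /flip /=; lia. Qed.

(** The reflection exchanges the end points [z] and [z + 1] of a cell. *)
Lemma cell_flip z I : cell (- z - 1) (flip I) = cell z I.
Proof. by rewrite /cell /flip /=; lia. Qed.

Lemma overlap_flip I J : overlap (flip I) (flip J) = overlap I J.
Proof. by rewrite /overlap /flip /=; lia. Qed.

Lemma cell_neq z z' I : cell z I -> ~~ cell z' I -> z' != z.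
Proof. by move=> zI; apply: contraNneq => ->. Qed.

(** A cell of [I] outside [K] lies to one side of a common cell [p], and [I]
reaches further than [K] on that side. *)
Lemma cell_side p z I K :
  cell p I -> cell p K -> cell z I -> ~~ cell z K ->
  (p < z /\ K.2 <= z < I.2) \/ (z < p /\ I.1 <= z < K.1).
Proof. by unfold_ivl; lia. Qed.

Lemma count_cells (zs : seq int) (a b : int) :
  uniq zs -> all (fun z => a <= z < b) zs -> a <= b -> a + (size zs)%:Z <= b.
Proof.
move=> uzs /allP zab ab.
have : (size zs <= size [seq (a + i%:Z)%R | i <- iota 0 `|b - a|%N])%N.
  apply: uniq_leq_size => // z /zab zr; apply/mapP; exists `|z - a|%N.
    by rewrite mem_iota; lia.
  by lia.
by rewrite size_map size_iota; lia.
Qed.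

(** The counting principle behind all the bounds: successive intervals, together
with cells that avoid them, fill at most the whole strip. *)
Lemma count_strip (Is : seq ivl) (zs : seq int) (a b : int) :
  pairwise before Is ->
  all (fun I : ivl => [&& a <= I.1, I.1 <= I.2 & I.2 <= b]) Is ->
  uniq zs -> all (fun z => a <= z < b) zs ->
  all (fun I => all (fun z => ~~ cell z I) zs) Is -> a <= b ->
  a + (size zs)%:Z + \sum_(I <- Is) (I.2 - I.1) <= b.
Proof.
elim: Is a zs => [|I Is IH] a zs /=.
  by rewrite big_nil addr0 => _ _ *; apply: count_cells.
rewrite big_cons => /andP[/allP bI pw] /andP[/and3P[aI II Ib] /allP aIs].
move=> uzs /allP zab /andP[/allP zI /allP zIs] ab.
pose left_of z := z < I.1; pose ls := [seq z <- zs | left_of z].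
pose rs := [seq z <- zs | ~~ left_of z].
have Hl : a + (size ls)%:Z <= I.1.
  apply: count_cells => //; first exact: filter_uniq.
  by apply/allP=> z; rewrite mem_filter /left_of => /andP[h1 /zab]; lia.
have Hr : I.2 + (size rs)%:Z + \sum_(J <- Is) (J.2 - J.1) <= b.
  apply: IH => //.
  - apply/allP=> J JIs; have := aIs J JIs; have := bI J JIs.
    by rewrite /before; lia.
  - exact: filter_uniq.
  - apply/allP=> z; rewrite mem_filter /left_of => /andP[h1 zz].
    by have := zI z zz; have := zab z zz; rewrite /cell; lia.
  apply/allP=> J JIs; apply/allP=> z; rewrite mem_filter => /andP[_ zzs].
  by have /allP := zIs J JIs; apply.
have : size zs = (size ls + size rs)%N.
  by rewrite !size_filter -(count_predC left_of).
move: Hl Hr; move: (size zs) (size ls) (size rs) (\sum_(J <- Is) _) => k m n u.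
by clear; lia.
Qed.

(** Pairwise overlapping intervals share a cell: the first cell of the one that
starts last. *)
Lemma helly (T : finType) (Z : T -> ivl) (P : pred T) :
  {in P &, forall a b, overlap (Z a) (Z b)} ->
  exists z, {in P, forall a, cell z (Z a)}.
Proof.
move=> mt; case: (pickP P) => [a0 Pa0|no]; last first.
  by exists 0 => a; rewrite unfold_in no.
case: (Order.TotalTheory.arg_maxP (fun a => (Z a).1) Pa0) => m Pm max.
exists (Z m).1 => a Pa; have := mt a m Pa Pm; have := max a Pa.
by unfold_ivl; lia.
Qed.

(** * Layouts in which all rectangles see each other *)

(** The line of sight runs along the projection [U] at the position [z] of the
projection [V]; [sight X Y] is horizontal sight and [sight Y X] vertical
sight. *)
Definition sight (T : Type) (U V : T -> ivl) (a b : T) : Prop :=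
  exists z, [/\ cell z (V a), cell z (V b)
    & forall k, cell z (V k) -> ~~ between (U a) (U k) (U b)].

Record layout (T : eqType) (X Y : T -> ivl) : Prop := Layout {
  thick : forall a, (X a).1 < (X a).2 /\ (Y a).1 < (Y a).2;
  apart : forall a b, a != b ->
    ~~ (overlap (X a) (X b) && overlap (Y a) (Y b));
  seen : forall a b, a != b -> sight X Y a b \/ sight Y X a b }.

Lemma layoutC (T : eqType) (X Y : T -> ivl) : layout X Y -> layout Y X.
Proof.
case=> th ap se; split=> [a|a b /ap|a b /se []]; first by have [] := th a.
- by rewrite andbC.
- by right.
- by left.
Qed.

Lemma sight_flipl (T : Type) (U V : T -> ivl) a b :
  sight U V a b -> sight (flip \o U) V a b.
Proof.
by case=> z [za zb zk]; exists z; split=> // k /zk /=; rewrite between_flip.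
Qed.

Lemma sight_flipr (T : Type) (U V : T -> ivl) a b :
  sight U V a b -> sight U (flip \o V) a b.
Proof.
have zK (z : int) : - (- z - 1) - 1 = z by lia.
case=> z [za zb zk]; exists (- z - 1); split; rewrite /= ?cell_flip //.
by move=> k; rewrite cell_flip => /zk.
Qed.

Lemma layout_flipX (T : eqType) (X Y : T -> ivl) :
  layout X Y -> layout (flip \o X) Y.
Proof.
case=> th ap se; split=> [a|a b /ap|a b /se []].
- by have [] := th a; rewrite /flip /=; lia.
- by rewrite /= overlap_flip.
- by left; apply: sight_flipl.
- by right; apply: sight_flipr.
Qed.

Lemma layout_flipY (T : eqType) (X Y : T -> ivl) :
  layout X Y -> layout X (flip \o Y).
Proof. by move/layoutC/layout_flipX/layoutC. Qed.

Section Layout.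
Variables (T : eqType) (X Y : T -> ivl).
Hypothesis lay : layout X Y.

Lemma before_neq a b : before (Y a) (Y b) -> a != b.
Proof.
by apply: contraTneq => ->; have := thick lay b; unfold_ivl; lia.
Qed.

Lemma before_trans a b c :
  before (Y a) (Y b) -> before (Y b) (Y c) -> before (Y a) (Y c).
Proof. by have := thick lay b; unfold_ivl; lia. Qed.

Lemma one_overlap a b : a != b -> overlap (Y a) (Y b) = ~~ overlap (X a) (X b).
Proof.
move=> ab; have := apart lay ab.
have := thick lay a; have := thick lay b.
by case: (seen lay ab) => -[z [za zb _]]; move: za zb; clear; unfold_ivl; lia.
Qed.

(** Vertical sight at the column [z] for [a] before [b] in the second
projection, where only one of the two orders in [between] can occur. *)
Definition joins (z : int) (a b : T) : Prop :=
  [/\ cell z (X a), cell z (X b) & forall k,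
    before (Y a) (Y k) -> before (Y k) (Y b) -> ~~ cell z (X k)].

Lemma column a b : before (Y a) (Y b) -> exists z, joins z a b.
Proof.
move=> ab; case: (seen lay (before_neq ab)) => -[z [za zb zk]].
  by move: ab za zb; clear; unfold_ivl; lia.
exists z; split=> // k ak kb; apply: contraL (zk k) _.
by rewrite /between ak kb.
Qed.

(** Let [a], [b], [c], [d] be stacked in this order through a column [p].  The
column where [a] sees [c] lies where [b] has ended and [c] has not; the column
where [b] sees [d] lies where [c] has ended and [b] has not.  So these columns
are on opposite sides of [p].  With five rectangles, 13 and 35 are on one side
of [p] and 24 on the other.  On the former side [b3] outlasts [b2] and [b4], so
both 14 and 25 lie on the latter; but 14 needs [b4] to outlast [b2] there, and
25 needs the opposite. *)
Lemma stack_lt5 p b1 b2 b3 b4 b5 :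
  [&& cell p (X b1), cell p (X b2), cell p (X b3), cell p (X b4)
    & cell p (X b5)] ->
  before (Y b1) (Y b2) -> before (Y b2) (Y b3) -> before (Y b3) (Y b4) ->
  before (Y b4) (Y b5) -> False.
Proof.
move=> /and5P[p1 p2 p3 p4 p5] s12 s23 s34 s45.
have s13 := before_trans s12 s23; have s24 := before_trans s23 s34.
have s35 := before_trans s34 s45.
have [z13 [a1 a3 /(_ b2 s12 s23) a2]] := column s13.
have [z24 [c2 c4 /(_ b3 s23 s34) c3]] := column s24.
have [z35 [d3 d5 /(_ b4 s34 s45) d4]] := column s35.
have [z14 [e1 e4 e]] := column (before_trans s13 s34).
have [z25 [f2 f5 f]] := column (before_trans s24 s45).
have e2 := e b2 s12 s24; have e3 := e b3 s13 s34.
have f3 := f b3 s23 s35; have f4 := f b4 s24 s45.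
clear e f s12 s13 s23 s34 s24 s35 s45 lay.
case: (cell_side p1 p2 a1 a2) => a; case: (cell_side p2 p3 c2 c3) => c;
  try (by clear -a c a3 c4; unfold_ivl; lia);
  case: (cell_side p3 p4 d3 d4) => d;
  try (by clear -d c d5 c4; unfold_ivl; lia);
  case: (cell_side p1 p2 e1 e2) => e; case: (cell_side p2 p3 f2 f3) => f;
  by unfold_ivl; lia.
Qed.

Section FourStacked.
Variables (p : int) (b1 b2 b3 b4 c : T).
Hypothesis ps :
  [&& cell p (X b1), cell p (X b2), cell p (X b3) & cell p (X b4)].
Hypotheses (s12 : before (Y b1) (Y b2)) (s23 : before (Y b2) (Y b3)).
Hypothesis s34 : before (Y b3) (Y b4).

(** Otherwise [c] would see [b3] where [b1] and [b2] have ended.  On the side of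
24, [b2] outlasts [b3], so this happens on the side of 13, and [b3] outlasts
[b1] there.  Since [b1] outlasts [b2] and [b3] where it sees [b4], column 14 is
on the side of 24.  Hence [b1] outlasts [b2] on both sides, and [c] cannot see
[b2]. *)
Lemma no_post_first : before (Y c) (Y b1) -> False.
Proof.
move=> s1; move: ps => /and4P[p1 p2 p3 p4].
have s2 := before_trans s1 s12; have s3 := before_trans s2 s23.
have s13 := before_trans s12 s23; have s24 := before_trans s23 s34.
have [z13 [a1 a3 /(_ b2 s12 s23) a2]] := column s13.
have [z24 [e2 e4 /(_ b3 s23 s34) e3]] := column s24.
have [z14 [d1 d4 d]] := column (before_trans s12 s24).
have d2 := d b2 s12 s24; have d3 := d b3 s13 s34.
have [x3 [_ g3 g]] := column s3.
have g1 := g b1 s1 s13; have g2 := g b2 s2 s23.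
have [x2 [_ h2 /(_ b1 s1 s12) h1]] := column s2.
clear g d s12 s23 s34 s1 s2 s3 s13 s24 ps lay.
case: (cell_side p1 p2 a1 a2) => a; case: (cell_side p2 p3 e2 e3) => e;
  try (by clear -a e a3 e4; unfold_ivl; lia);
  case: (cell_side p3 p1 g3 g1) => g;
  try (by clear -a e a3 e4 g g2; unfold_ivl; lia);
  case: (cell_side p1 p2 d1 d2) => d;
  try (by clear -a e a3 e4 g g2 d d3 d4; unfold_ivl; lia).
all: by unfold_ivl; lia.
Qed.

(** Here [c] blocks the sight of [b1] to [b2] and to [b3] in all its columns. It
sees [b4] in a column [x4] where [b2] and [b3] have ended.  If 13 is on the same
side as [x4], it lies between [p] and [c] but beyond the end of [b2], so that
[c] misses [b2].  If it is on the other side, so is the column [x3] where [c]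
sees [b3] and [b2] has ended.  Then [c] fills all columns from [x3] to [x4],
outside of which there is no [b2], and [b1] cannot see [b2]. *)
Lemma no_post_second : before (Y b1) (Y c) -> before (Y c) (Y b2) -> False.
Proof.
move=> s1 s2; move: ps => /and4P[p1 p2 p3 p4].
have s3 := before_trans s2 s23.
have s4 := before_trans s3 s34; have s24 := before_trans s23 s34.
have s13 := before_trans s12 s23; have s14 := before_trans s12 s24.
have [z13 [a1 a3 a]] := column s13.
have a2 := a b2 s12 s23; have ac := a c s1 s3.
have [z24 [e2 e4 /(_ b3 s23 s34) e3]] := column s24.
have [z12 [d1 d2 /(_ c s1 s2) dc]] := column s12.
have [x4 [fc f4 f]] := column s4.
have f2 := f b2 s2 s24; have f3 := f b3 s3 s34.
have [x3 [gc g3 /(_ b2 s2 s23) g2]] := column s3.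
have [x2 [hc h2 _]] := column s2.
clear a f s12 s23 s34 s1 s2 s3 s4 s24 s13 s14 ps lay.
case: (cell_side p1 p2 a1 a2) => a; case: (cell_side p2 p3 e2 e3) => e;
  try (by clear -a e a3 e4; unfold_ivl; lia);
  case: (cell_side p4 p2 f4 f2) => f; case: (cell_side p3 p2 g3 g2) => g;
  try (by clear -a e a3 e4 f f3 g; unfold_ivl; lia);
  by unfold_ivl; lia.
Qed.

(** Here [c] blocks 13, 23 and 24.  It sees [b1] in a column [x1] where [b2] has
ended, and [b4] in a column [x4] where [b3] has ended.  If [x1] is on the side
of 24, then 24 lies between [p] and [c] but beyond the end of [b3], so that [c]
misses [b3]; if [x4] is on the side of 13, then [c] misses [b2] likewise.
Otherwise [c] fills all columns from [x1] to [x4], beyond which [b2] or [b3] has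
ended, and [b2] cannot see [b3]. *)
Lemma no_post_middle : before (Y b2) (Y c) -> before (Y c) (Y b3) -> False.
Proof.
move=> s2 s3; move: ps => /and4P[p1 p2 p3 p4].
have s1 := before_trans s12 s2.
have s4 := before_trans s3 s34; have s24 := before_trans s23 s34.
have s13 := before_trans s12 s23.
have [z13 [a1 a3 a]] := column s13.
have a2 := a b2 s12 s23; have ac := a c s1 s3.
have [z24 [e2 e4 e]] := column s24.
have e3 := e b3 s23 s34; have ec := e c s2 s4.
have [z23 [d2 d3 /(_ c s2 s3) dc]] := column s23.
have [x4 [fc f4 /(_ b3 s3 s34) f3]] := column s4.
have [x1 [g1 gc /(_ b2 s12 s2) g2]] := column s1.
have [x2 [h2 hc _]] := column s2.
have [x3 [jc j3 _]] := column s3.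
clear a e s12 s23 s34 s1 s2 s3 s4 s24 s13 ps lay.
case: (cell_side p1 p2 a1 a2) => a; case: (cell_side p2 p3 e2 e3) => e;
  try (by clear -a e a3 e4; unfold_ivl; lia);
  case: (cell_side p4 p3 f4 f3) => f; case: (cell_side p1 p2 g1 g2) => g;
  by unfold_ivl; lia.
Qed.
End FourStacked.

(** In a column where [a] sees [b], a rectangle [c] cannot lie between them, so
it must precede [a] or follow [b] if it meets that column. *)
Lemma joins_off z a b c : c != a -> c != b -> joins z a b ->
  ~~ before (Y c) (Y a) -> ~~ before (Y b) (Y c) -> ~~ cell z (X c).
Proof.
move=> ca cb [za zb H] nca nbc; apply/negP => zc.
have ya := one_overlap ca; have yb := one_overlap cb.
suff: ~~ cell z (X c) by rewrite zc.
apply: H; first by move: ya nca za zc; clear; unfold_ivl; lia.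
by move: yb nbc zb zc; clear; unfold_ivl; lia.
Qed.

(** Each of [a] and [c] sees the other in a column which [b] leaves free,
besides a column which it shares with [b]. *)
Lemma widen2 a b c : before (Y a) (Y b) -> before (Y b) (Y c) ->
  (X a).1 + 2 <= (X a).2 /\ (X c).1 + 2 <= (X c).2.
Proof.
move=> ab bc; have [z [za zc /(_ b ab bc) zb]] := column (before_trans ab bc).
have [x [xa xb _]] := column ab; have [y [yb yc _]] := column bc.
by clear -za zc zb xa xb yb yc; unfold_ivl; lia.
Qed.

Lemma widen3 a b c d : before (Y a) (Y b) -> before (Y b) (Y c) ->
  before (Y c) (Y d) -> (X a).1 + 3 <= (X a).2 /\ (X d).1 + 3 <= (X d).2.
Proof.
move=> ab bc cd; have ac := before_trans ab bc; have bd := before_trans bc cd.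
have [z [za zd H]] := column (before_trans ac cd).
have zb := H b ab bd; have zc := H c ac cd.
have [y [ya yc /(_ b ab bc) yb]] := column ac.
have [x [xa xb _]] := column ab.
have [v [vb vd /(_ c bc cd) vc]] := column bd.
have [u [uc ud _]] := column cd.
split; first by clear -za zb zc ya yc yb xa xb; unfold_ivl; lia.
by clear -zd zb zc vb vd vc uc ud; unfold_ivl; lia.
Qed.
End Layout.

(** * Four stacked rectangles and three side by side *)

Record crossing (T : eqType) (X Y : T -> ivl) (p t : int)
    (b1 b2 b3 b4 c1 c2 c3 : T) : Prop := Crossing {
  cr_layout : layout X Y;
  cr_stack :
    [/\ before (Y b1) (Y b2), before (Y b2) (Y b3) & before (Y b3) (Y b4)];
  cr_side : before (X c1) (X c2) && before (X c2) (X c3);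
  cr_p : [&& cell p (X b1), cell p (X b2), cell p (X b3) & cell p (X b4)];
  cr_t : [&& cell t (Y c1), cell t (Y c2) & cell t (Y c3)];
  cr_neq : {in [:: b1; b2; b3; b4] & [:: c1; c2; c3], forall b c, c != b} }.

Section Flips.
Variables (T : eqType) (X Y : T -> ivl) (p t : int).
Variables (b1 b2 b3 b4 c1 c2 c3 : T).
Hypothesis cr : crossing X Y p t b1 b2 b3 b4 c1 c2 c3.

Lemma crossing_flipX :
  crossing (flip \o X) Y (- p - 1) t b1 b2 b3 b4 c3 c2 c1.
Proof.
case: cr => la st ro cp ct ne; split=> //=.
- exact: layout_flipX.
- by rewrite !before_flip andbC.
- by rewrite !cell_flip.
- by case/and3P: ct => -> -> ->.
by move=> b c hb hc; apply: ne => //; rewrite -mem_rev.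
Qed.

Lemma crossing_flipY :
  crossing X (flip \o Y) p (- t - 1) b4 b3 b2 b1 c1 c2 c3.
Proof.
case: cr => la [s1 s2 s3] ro /and4P[p1 p2 p3 p4] ct ne; split=> //=.
- exact: layout_flipY.
- by rewrite !before_flip.
- by rewrite p1 p2 p3 p4.
- by rewrite !cell_flip.
by move=> b c hb hc; apply: ne => //; rewrite -mem_rev.
Qed.
End Flips.

Section Crossing.
Variables (T : eqType) (X Y : T -> ivl) (p t : int).
Variables (b1 b2 b3 b4 c1 c2 c3 : T).
Hypothesis cr : crossing X Y p t b1 b2 b3 b4 c1 c2 c3.
Let lay := cr_layout cr.
Let layC := layoutC lay.
Notation bs := [:: b1; b2; b3; b4].
Notation cs := [:: c1; c2; c3].

Lemma in_bs : [/\ b1 \in bs, b2 \in bs, b3 \in bs & b4 \in bs].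
Proof. by rewrite !inE !eqxx !orbT. Qed.

Lemma in_cs : [/\ c1 \in cs, c2 \in cs & c3 \in cs].
Proof. by rewrite !inE !eqxx !orbT. Qed.

Lemma in_p b : b \in bs -> cell p (X b).
Proof. by have /and4P[? ? ? ?] := cr_p cr; rewrite !inE => /or4P[]/eqP->. Qed.

Lemma in_t c : c \in cs -> cell t (Y c).
Proof. by have /and3P[? ? ?] := cr_t cr; rewrite !inE => /or3P[]/eqP->. Qed.

(** Otherwise [c] would be disjoint from all four in the second projection and
so have a position in the stack; the last two positions reduce to the first two
by reflection. *)
Lemma overlaps_some c : c \in cs ->
  exists2 b, b \in bs & overlap (Y c) (Y b).
Proof.
move=> hc; apply/hasP; apply/negPn/negP=> no.
have [s12 s23 s34] := cr_stack cr; have [i1 i2 i3 i4] := in_bs.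
have sep b : b \in bs -> ~~ before (Y c) (Y b) -> before (Y b) (Y c).
  by move=> /(hasPn no); clear; unfold_ivl; lia.
case: (boolP (before (Y c) (Y b1))) => [|/(sep _ i1) h1].
  exact: (no_post_first lay (cr_p cr) s12 s23 s34).
case: (boolP (before (Y c) (Y b2))) => [|/(sep _ i2) h2].
  exact: (no_post_second lay (cr_p cr) s12 s23 s34 h1).
case: (boolP (before (Y c) (Y b3))) => [|/(sep _ i3) h3].
  exact: (no_post_middle lay (cr_p cr) s12 s23 s34 h2).
have crf := crossing_flipY cr; have [f12 f23 f34] := cr_stack crf.
case: (boolP (before (Y c) (Y b4))) => [c4|/(sep _ i4) h4].
  by apply: (no_post_second (cr_layout crf) (cr_p crf) f12 f23 f34 (c := c));
    rewrite /= before_flip.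
by apply: (no_post_first (cr_layout crf) (cr_p crf) f12 f23 f34 (c := c));
  rewrite /= before_flip.
Qed.

Lemma off_p c : c \in cs -> ~~ cell p (X c).
Proof.
move=> hc; have [b hb cb] := overlaps_some hc.
have := one_overlap lay (cr_neq cr hb hc); rewrite cb.
by move: (in_p hb); clear; unfold_ivl; lia.
Qed.

(** ** Counting columns *)

Section Columns.
Variables (x0 x1 : int).
Hypothesis strip : forall a, x0 <= (X a).1 /\ (X a).2 <= x1.

Notation widths :=
  ((X c1).2 - (X c1).1 + ((X c2).2 - (X c2).1 + ((X c3).2 - (X c3).1))).

Lemma count_columns zs : uniq zs ->
  (forall z, z \in zs -> exists a, cell z (X a)) ->
  {in zs & cs, forall z c, ~~ cell z (X c)} ->
  x0 + (size zs)%:Z + widths <= x1.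
Proof.
move=> uzs zin zout; have [i1 i2 i3] := in_cs.
have := @count_strip [:: X c1; X c2; X c3] zs x0 x1.
rewrite !big_cons big_nil addr0; apply=> //=.
- have /andP[r12 r23] := cr_side cr; rewrite r12 r23 /= !andbT.
  by have := thick lay c2; move: r12 r23; clear; unfold_ivl; lia.
- have [h1 h2] := (strip c1, strip c2); have h3 := strip c3.
  have [g1 g2] := (thick lay c1, thick lay c2); have g3 := thick lay c3.
  by clear -h1 h2 h3 g1 g2 g3; lia.
- by apply/allP=> z /zin[a]; have := strip a; clear; unfold_ivl; lia.
- by rewrite andbT; apply/and3P; split; apply/allP=> z hz; apply: zout.
by have := strip c1; have := thick lay c1; clear; lia.
Qed.

(** The four columns are distinct because [b2] is missing in 13, [b2] and [b3]
are missing in 14, and [b3] is missing in 24. *)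
Lemma special_columns : exists z13 z14 z24, uniq [:: p; z13; z14; z24] /\
  [/\ joins X Y z13 b1 b3, joins X Y z14 b1 b4 & joins X Y z24 b2 b4].
Proof.
have [s12 s23 s34] := cr_stack cr.
have [s13 s24] := (before_trans lay s12 s23, before_trans lay s23 s34).
have /and4P[p1 p2 p3 p4] := cr_p cr.
have [z13 j13] := column lay s13.
have [z14 j14] := column lay (before_trans lay s12 s24).
have [z24 j24] := column lay s24.
exists z13, z14, z24; split=> //.
have [_ a3 /(_ b2 s12 s23) a2] := j13; have [e2 _ /(_ b3 s23 s34) e3] := j24.
have [_ _ d] := j14; have d2 := d b2 s12 s24; have d3 := d b3 s13 s34.
have [u1 u2 u3] := And3 (cell_neq p2 a2) (cell_neq p2 d2) (cell_neq a3 d3).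
have [v1 v2 v3] := And3 (cell_neq p3 e3) (cell_neq a3 e3) (cell_neq e2 d2).
by rewrite /= !inE; move: u1 u2 u3 v1 v2 v3; clear; lia.
Qed.

Lemma four_free z13 z14 z24 : uniq [:: p; z13; z14; z24] ->
  joins X Y z13 b1 b3 -> joins X Y z14 b1 b4 -> joins X Y z24 b2 b4 ->
  {in [:: z13; z14; z24] & cs, forall z c, ~~ cell z (X c)} ->
  x0 + 7 <= x1 /\ (x1 < x0 + 8 -> {in cs, forall c, (X c).2 < (X c).1 + 2}).
Proof.
move=> dist [a1 _ _] [d1 _ _] [e2 _ _] free.
have W : x0 + 4 + widths <= x1.
  apply: (count_columns dist) => [z|z c].
    have /and4P[p1 _ _ _] := cr_p cr; rewrite !inE.
    by case/or4P=> /eqP->; [exists b1 | exists b1 | exists b1 | exists b2].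
  by rewrite inE => /orP[/eqP-> /off_p|]; last exact: free.
have [[w1 _] [w2 _]] := (thick lay c1, thick lay c2).
have [w3 _] := thick lay c3.
split=> [|x7 c]; first by clear -W w1 w2 w3; lia.
by rewrite !inE => /or3P[]/eqP->; clear -W w1 w2 w3 x7; lia.
Qed.

(** The rectangles [b2], [b3], [b4] all follow the row [t], hence cannot precede
a [c].  Columns 13 and 14 avoid the [c]'s, as no [c] precedes the whole stack.
If some [c] overlaps [b2] in the first projection, it precedes three rectangles
of the stack and has width at least 3.  If none does, column 24 avoids the [c]'s
as well; with 7 columns all widths are then 1, whereas a [c] overlapping [b3] in
the first projection would precede [b3] and [b4]. *)
Lemma columns_below : t < (Y b2).1 ->
  x0 + 7 <= x1 /\ (x1 < x0 + 8 ->
    {in cs, forall c, overlap (Y c) (Y b2) && overlap (Y c) (Y b3)}).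
Proof.
move=> tb2; have [s12 s23 s34] := cr_stack cr.
have s24 := before_trans lay s23 s34; have [i1 i2 i3 i4] := in_bs.
have ne b c (hb : b \in bs) (hc : c \in cs) := cr_neq cr hb hc.
have [z13 [z14 [z24 [dist [j13 j14 j24]]]]] := special_columns.
have nfollow b c : c \in cs -> before (Y b2) (Y b) || (b == b2) ->
    ~~ before (Y b) (Y c).
  move=> /in_t tc h; apply/negP=> bc.
  have : t < (Y b).1.
    case/orP: h => [|/eqP->//]; move: tb2; have := thick lay b2.
    by clear; unfold_ivl; lia.
  by move: bc tc; have := thick lay b; clear; unfold_ivl; lia.
have nfirst c : ~~ before (Y c) (Y b1).
  by apply/negP; apply: (no_post_first lay (cr_p cr) s12 s23 s34).
have f13 c : c \in cs -> ~~ cell z13 (X c).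
  move=> hc; apply: (joins_off lay (ne _ _ i1 hc) (ne _ _ i3 hc) j13) => //.
  by apply: nfollow; rewrite ?s23.
have f14 c : c \in cs -> ~~ cell z14 (X c).
  move=> hc; apply: (joins_off lay (ne _ _ i1 hc) (ne _ _ i4 hc) j14) => //.
  by apply: nfollow; rewrite ?s24.
have [/hasP[c hc cb2]|/hasPn none] :=
    boolP (has (fun c => before (Y c) (Y b2)) cs).
  have [w _] := widen3 lay cb2 s23 s34.
  have W : x0 + 3 + widths <= x1.
    apply: (count_columns (zs := [:: p; z13; z14])).
    - by move: dist; rewrite /= !inE; clear; lia.
    - have [[? _ _] [? _ _]] := (j13, j14); have /and4P[? _ _ _] := cr_p cr.
      by move=> z; rewrite !inE => /or3P[]/eqP->; exists b1.
    move=> z c' hz hc'; move: hz; rewrite !inE => /or3P[]/eqP->.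
    - exact: off_p.
    - exact: f13.
    exact: f14.
  have [[w1 _] [w2 _]] := (thick lay c1, thick lay c2).
  have [w3 _] := thick lay c3.
  by move: hc w; rewrite !inE => /or3P[]/eqP->; clear -w1 w2 w3 W; lia.
have overlapN c b : c \in cs -> before (Y b2) (Y b) || (b == b2) ->
    overlap (Y c) (Y b) = ~~ before (Y c) (Y b).
  by move=> hc /(nfollow _ _ hc); clear; unfold_ivl; lia.
have m2 c : c \in cs -> overlap (Y c) (Y b2).
  by move=> hc; rewrite overlapN ?eqxx ?orbT // none.
have [|W7 W8] := four_free dist j13 j14 j24.
  move=> z c hz hc; move: hz; rewrite !inE => /or3P[]/eqP->;
    [exact: f13 | exact: f14 |].
  have := one_overlap lay (ne _ _ i2 hc); rewrite m2 //.
  by have [e2 _ _] := j24; move: e2; clear; unfold_ivl; lia.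
split=> // x7 c hc; rewrite m2 // overlapN ?s23 //; apply/negP=> cb3.
have [w _] := widen2 lay cb3 s34.
by have := W8 x7 c hc; move: w; clear; lia.
Qed.

(** The row [t] separates [b1] and [b2] from [b3] and [b4], except that it may
meet [b2] or [b3].  Hence a [c] in one of the columns 13, 14, 24 would lie
between the two rectangles which see each other there.  So these columns avoid
the [c]'s; with 7 columns all widths are 1, whereas a [c] overlapping
[b2] in the first projection would follow [b1] and [b2], and one overlapping
[b3] would precede [b3] and [b4]. *)
Lemma columns_mid : (Y b2).1 <= t -> t < (Y b3).2 ->
  x0 + 7 <= x1 /\ (x1 < x0 + 8 ->
    {in cs, forall c, overlap (Y c) (Y b2) && overlap (Y c) (Y b3)}).
Proof.
move=> b2t tb3; have [s12 s23 s34] := cr_stack cr; have [i1 i2 i3 i4] := in_bs.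
have ne b c (hb : b \in bs) (hc : c \in cs) := cr_neq cr hb hc.
have [z13 [z14 [z24 [dist [j13 j14 j24]]]]] := special_columns.
have lo2 c : c \in cs -> ~~ before (Y c) (Y b2).
  by move=> /in_t; move: b2t; clear; unfold_ivl; lia.
have lo1 c : c \in cs -> ~~ before (Y c) (Y b1).
  by move=> /in_t; move: b2t s12; have := thick lay b1; clear; unfold_ivl; lia.
have hi3 c : c \in cs -> ~~ before (Y b3) (Y c).
  by move=> /in_t; move: tb3; clear; unfold_ivl; lia.
have hi4 c : c \in cs -> ~~ before (Y b4) (Y c).
  by move=> /in_t; move: tb3 s34; have := thick lay b4; clear; unfold_ivl; lia.
have [|W7 W8] := four_free dist j13 j14 j24.
  move=> z c hz hc; have [n1 n2] := (ne _ _ i1 hc, ne _ _ i2 hc).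
  have [n3 n4] := (ne _ _ i3 hc, ne _ _ i4 hc).
  move: hz; rewrite !inE => /or3P[]/eqP->.
  - exact: (joins_off lay n1 n3 j13 (lo1 c hc) (hi3 c hc)).
  - exact: (joins_off lay n1 n4 j14 (lo1 c hc) (hi4 c hc)).
  exact: (joins_off lay n2 n4 j24 (lo2 c hc) (hi4 c hc)).
split=> // x7 c hc; have w := W8 x7 c hc.
apply/andP; split; apply/negPn/negP=> nm.
  have b2c : before (Y b2) (Y c).
    by move: nm (lo2 c hc); clear; unfold_ivl; lia.
  by have [_] := widen2 lay s12 b2c; move: w; clear; lia.
have cb3 : before (Y c) (Y b3).
  by move: nm (hi3 c hc); clear; unfold_ivl; lia.
by have [] := widen2 lay cb3 s34; move: w; clear; lia.
Qed.
End Columns.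

(** ** Counting rows *)

Section Rows.
Variables (y0 y1 : int).
Hypothesis strip : forall a, y0 <= (Y a).1 /\ (Y a).2 <= y1.

Notation heights := ((Y b1).2 - (Y b1).1 + ((Y b2).2 - (Y b2).1 +
  ((Y b3).2 - (Y b3).1 + ((Y b4).2 - (Y b4).1)))).

Lemma count_rows zs : uniq zs ->
  (forall z, z \in zs -> exists a, cell z (Y a)) ->
  {in zs & bs, forall z b, ~~ cell z (Y b)} ->
  y0 + (size zs)%:Z + heights <= y1.
Proof.
move=> uzs zin zout; have [i1 i2 i3 i4] := in_bs.
have [s12 s23 s34] := cr_stack cr.
have [s13 s24] := (before_trans lay s12 s23, before_trans lay s23 s34).
have := @count_strip [:: Y b1; Y b2; Y b3; Y b4] zs y0 y1.
rewrite !big_cons big_nil addr0; apply=> //=.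
- by rewrite s12 s13 s23 s24 s34 (before_trans lay s12 s24).
- have [h1 h2] := (strip b1, strip b2); have [h3 h4] := (strip b3, strip b4).
  have [g1 g2] := (thick lay b1, thick lay b2).
  have [g3 g4] := (thick lay b3, thick lay b4).
  by clear -h1 h2 h3 h4 g1 g2 g3 g4; lia.
- by apply/allP=> z /zin[a]; have := strip a; clear; unfold_ivl; lia.
- by rewrite andbT; apply/and4P; split; apply/allP=> z hz; apply: zout.
by have := strip b1; have := thick lay b1; clear; lia.
Qed.

Lemma left_overlap c b : c \in cs -> b \in bs -> (X c).2 <= p ->
  overlap (Y c) (Y b) -> before (X c) (X b).
Proof.
move=> hc hb cp; rewrite (one_overlap lay (cr_neq cr hb hc)).
by have := thick lay c; move: (in_p hb) cp; clear; unfold_ivl; lia.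
Qed.

(** A [b] met by a row where [c1] or [c2] sees [c3] would lie between them,
since it meets [p].  So the rows where [c1] sees [c3] and where [c2] sees [c3]
avoid the stack; they differ because [c2] is missing in the former.  A [b] that
overlaps [c2] in the second projection has [c1] and [c2] in front of it, hence
has height at least 2. *)
Lemma rows_two_sided : (X c2).2 <= p -> p < (X c3).1 ->
  y0 + 7 <= y1 /\
  (overlap (Y c2) (Y b2) && overlap (Y c2) (Y b3) -> y0 + 8 <= y1).
Proof.
move=> l2 r3; have /andP[r12 r23] := cr_side cr; have [hc1 hc2 hc3] := in_cs.
have [_ i2 i3 _] := in_bs.
have [y13 j13] := column layC (before_trans layC r12 r23).
have [y23 j23] := column layC r23.
have [a1 _ /(_ c2 r12 r23) a2] := j13; have [e2 _ _] := j23.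
have lo c b : b \in bs -> (X c).2 <= p -> ~~ before (X b) (X c).
  by move=> /in_p; have := thick lay c; clear; unfold_ivl; lia.
have hi b : b \in bs -> ~~ before (X c3) (X b).
  by move=> /in_p; have := thick lay c3; move: r3; clear; unfold_ivl; lia.
have ne b c : b \in bs -> c \in cs -> b != c.
  by move=> hb hc; rewrite eq_sym; apply: (cr_neq cr).
have l1 : (X c1).2 <= p.
  by move: r12 l2; have := thick lay c2; clear; unfold_ivl; lia.
have W : y0 + 2 + heights <= y1.
  apply: (count_rows (zs := [:: y13; y23])).
  - by rewrite /= inE (cell_neq e2 a2).
  - by move=> z; rewrite !inE => /orP[]/eqP->; [exists c1 | exists c2].
  move=> z b hz hb; have [n1 n2] := (ne b c1 hb hc1, ne b c2 hb hc2).
  have n3 := ne b c3 hb hc3; move: hz; rewrite !inE => /orP[]/eqP->.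
    exact: (joins_off layC n1 n3 j13 (lo _ _ hb l1) (hi _ hb)).
  exact: (joins_off layC n2 n3 j23 (lo _ _ hb l2) (hi _ hb)).
have tall b : b \in bs -> overlap (Y c2) (Y b) -> (Y b).1 + 2 <= (Y b).2.
  by move=> hb /(left_overlap hc2 hb l2)/(widen2 layC r12)[].
have [[_ g1] [_ g2]] := (thick lay b1, thick lay b2).
have [[_ g3] [_ g4]] := (thick lay b3, thick lay b4).
split; last first.
  by case/andP=> /(tall _ i2) k2 /(tall _ i3) k3; clear -W g1 g4 k2 k3; lia.
have [b hb /(tall _ hb)] := overlaps_some hc2.
by move: hb; rewrite !inE => /or4P[]/eqP->; clear -W g1 g2 g3 g4; lia.
Qed.

(** A [b] that overlaps [c3] in the second projection has [c1], [c2], [c3] in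
front of it, hence has height at least 3.  To gain one more row, consider [t]
and the row where [c1] sees [c3], which differ since only [t] meets [c2].  If
one of them avoids the stack, it is the extra row.  If they meet two different
rectangles of the stack, both of these have height 3.  If they meet the same
one, it has height 4, since it sees [c1] and [c2] in two further rows. *)
Lemma rows_one_sided : (X c3).2 <= p ->
  y0 + 7 <= y1 /\
  (overlap (Y c3) (Y b2) && overlap (Y c3) (Y b3) -> y0 + 8 <= y1).
Proof.
move=> l3; have /andP[r12 r23] := cr_side cr; have [hc1 hc2 hc3] := in_cs.
have [_ i2 i3 _] := in_bs; have r13 := before_trans layC r12 r23.
have [y13 [a1 a3 /(_ c2 r12 r23) a2]] := column layC r13.
have /and3P[t1 t2 t3] := cr_t cr.
have l3b b : b \in bs -> overlap (Y c3) (Y b) -> before (X c3) (X b).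
  by move=> hb /(left_overlap hc3 hb l3).
have tall3 b : b \in bs -> overlap (Y c3) (Y b) -> (Y b).1 + 3 <= (Y b).2.
  by move=> hb /(l3b _ hb)/(widen3 layC r12 r23)[].
have m3 z b : cell z (Y c3) -> cell z (Y b) -> overlap (Y c3) (Y b).
  by clear; unfold_ivl; lia.
have tall4 b : b \in bs -> cell t (Y b) -> cell y13 (Y b) ->
    (Y b).1 + 4 <= (Y b).2.
  move=> hb tb yb; have cb := l3b b hb (m3 _ _ t3 tb).
  have cb2 := before_trans layC r23 cb.
  have [v [v1 v2 V]] := column layC (before_trans layC r13 cb).
  have vb := V c2 r12 cb2; have vc := V c3 r13 cb.
  have [u [u2 ub /(_ c3 r23 cb) u3]] := column layC cb2.
  by clear -a3 a2 t2 t3 tb yb v2 vb vc u2 ub u3; unfold_ivl; lia.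
have W0 : y0 + 0 + heights <= y1 by apply: (count_rows (zs := [::])).
have [[_ g1] [_ g2]] := (thick lay b1, thick lay b2).
have [[_ g3] [_ g4]] := (thick lay b3, thick lay b4).
split; last first.
  by case/andP=> /(tall3 _ i2) k2 /(tall3 _ i3) k3; clear -W0 g1 g4 k2 k3; lia.
have free z : cell z (Y c3) -> ~~ has (fun b => cell z (Y b)) bs ->
    y0 + 7 <= y1.
  move=> zc /hasPn no.
  have W : y0 + 1 + heights <= y1.
    apply: (count_rows (zs := [:: z])) => // [x|x b];
      rewrite mem_seq1 => /eqP->.
      by exists c3.
    exact: no.
  have [b hb /(tall3 _ hb)] := overlaps_some hc3.
  by move: hb; rewrite !inE => /or4P[]/eqP->; clear -W g1 g2 g3 g4; lia.
have [/hasP[b hb tb]|/(free _ t3)//] := boolP (has (fun b => cell t (Y b)) bs).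
have [/hasP[b' hb' yb]|/(free _ a3)//] :=
  boolP (has (fun b => cell y13 (Y b)) bs).
have k := tall3 b hb (m3 _ _ t3 tb); have k' := tall3 b' hb' (m3 _ _ a3 yb).
have [eb|] := eqVneq b b'.
  have := tall4 b hb tb; rewrite eb => /(_ yb).
  by move: hb'; rewrite !inE => /or4P[]/eqP->; clear -W0 g1 g2 g3 g4; lia.
move: hb hb' k k'; rewrite !inE => /or4P[]/eqP-> /or4P[]/eqP->;
  rewrite ?eqxx //; by clear -W0 g1 g2 g3 g4; lia.
Qed.
End Rows.
End Crossing.

Lemma columns_needed (T : eqType) (X Y : T -> ivl) (p t : int)
    (b1 b2 b3 b4 c1 c2 c3 : T) (x0 x1 : int) :
  crossing X Y p t b1 b2 b3 b4 c1 c2 c3 ->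
  (forall a, x0 <= (X a).1 /\ (X a).2 <= x1) ->
  x0 + 7 <= x1 /\ (x1 < x0 + 8 -> {in [:: c1; c2; c3], forall c,
    overlap (Y c) (Y b2) && overlap (Y c) (Y b3)}).
Proof.
move=> cr strip; case: (ltP t (Y b2).1) => [|b2t].
  exact: (columns_below cr strip).
case: (ltP t (Y b3).2) => [|b3t]; first exact: (columns_mid cr strip).
have [|W7 W8] := columns_below (crossing_flipY cr) strip.
  by rewrite /flip /=; lia.
by split=> // /W8 H c /H /=; rewrite !overlap_flip andbC.
Qed.

Lemma rows_needed (T : eqType) (X Y : T -> ivl) (p t : int)
    (b1 b2 b3 b4 c1 c2 c3 : T) (y0 y1 : int) :
  crossing X Y p t b1 b2 b3 b4 c1 c2 c3 ->
  (forall a, y0 <= (Y a).1 /\ (Y a).2 <= y1) ->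
  y0 + 7 <= y1 /\ ({in [:: c1; c2; c3], forall c,
    overlap (Y c) (Y b2) && overlap (Y c) (Y b3)} -> y0 + 8 <= y1).
Proof.
move=> cr strip; have crf := crossing_flipX cr.
have [i1 i2 i3] := in_cs c1 c2 c3.
have off c : c \in [:: c1; c2; c3] -> (X c).2 <= p \/ p < (X c).1.
  by move/(off_p cr); clear; unfold_ivl; lia.
case: (off c2 i2) => h2.
  case: (off c3 i3) => h3.
    by have [H7 H8] := rows_one_sided cr strip h3; split=> // H; apply/H8/H.
  by have [H7 H8] := rows_two_sided cr strip h2 h3; split=> // H; apply/H8/H.
case: (off c1 i1) => h1.
  have [||H7 H8] := rows_two_sided crf strip; rewrite /flip /=.
  - by move: h2; clear; lia.
  - by move: h1; clear; lia.
  by split=> // H; apply/H8/H.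
have [|H7 H8] := rows_one_sided crf strip; rewrite /flip /=.
  by move: h1; clear; lia.
by split=> // H; apply/H8/H.
Qed.

Lemma crossing_size (T : eqType) (X Y : T -> ivl) (p t : int)
    (b1 b2 b3 b4 c1 c2 c3 : T) (x0 x1 y0 y1 : int) :
  crossing X Y p t b1 b2 b3 b4 c1 c2 c3 ->
  (forall a, x0 <= (X a).1 /\ (X a).2 <= x1) ->
  (forall a, y0 <= (Y a).1 /\ (Y a).2 <= y1) ->
  [/\ 7 <= x1 - x0, 7 <= y1 - y0 & 15 <= (x1 - x0) + (y1 - y0)].
Proof.
move=> cr stripX stripY; have [W7 W8] := columns_needed cr stripX.
have [H7 H8] := rows_needed cr stripY.
case: (ltP x1 (x0 + 8)) => [/W8/H8|]; first by clear -W7; split; lia.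
by clear -H7; split; lia.
Qed.

(** * Splitting a layout into stacked and side by side rectangles *)

Section Split.
Variables (T : finType) (X Y : T -> ivl).
Hypothesis lay : layout X Y.

(** Otherwise, in the second projection, [c] and [d] would both overlap [a] and
[b], hence cover the gap between them and overlap each other. *)
Lemma no_two_edges a b c d : a != b -> c != d ->
  overlap (X a) (X b) -> overlap (X c) (X d) ->
  [|| overlap (X a) (X c), overlap (X a) (X d), overlap (X b) (X c)
    | overlap (X b) (X d)].
Proof.
move=> ab cd mab mcd; apply/negPn/negP; rewrite !negb_or => /and4P[ac ad bc bd].
have ne u v : ~~ overlap (X u) (X v) -> u != v.
  by apply: contraNneq => ->; have [] := thick lay v; clear; unfold_ivl; lia.
have yac := one_overlap lay (ne _ _ ac).
have yad := one_overlap lay (ne _ _ ad).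
have ybc := one_overlap lay (ne _ _ bc).
have ybd := one_overlap lay (ne _ _ bd).
have yab := one_overlap lay ab; have ycd := one_overlap lay cd.
move: yac yad ybc ybd yab ycd; rewrite mab mcd ac ad bc bd; clear.
by unfold_ivl; lia.
Qed.

(** The unions of two overlapping intervals are intervals, which pairwise
overlap by [no_two_edges].  A cell [p] common to all these unions meets one
interval of every overlapping pair. *)
Lemma split_column : exists p,
  {in [pred a | ~~ cell p (X a)] &, forall a b,
    a != b -> ~~ overlap (X a) (X b)}.
Proof.
pose edge (e : T * T) := (e.1 != e.2) && overlap (X e.1) (X e.2).
pose hull (e : T * T) : ivl :=
  (Num.min (X e.1).1 (X e.2).1, Num.max (X e.1).2 (X e.2).2).
have [|p pe] := @helly _ hull edge.
  move=> [a b] [c d] /andP[/= ab mab] /andP[/= cd mcd].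
  have meet := no_two_edges ab cd mab mcd; move: meet mab mcd; clear.
  by rewrite /hull /=; unfold_ivl => /=; lia.
exists p => a b; rewrite !inE => pa pb ab; apply/negP=> mab.
have /pe : edge (a, b) by rewrite /edge ab.
by move: mab pa pb; clear; rewrite /hull /=; unfold_ivl => /=; lia.
Qed.

Lemma stack_sort (A : {pred T}) :
  {in A &, forall a b, a != b -> ~~ overlap (Y a) (Y b)} ->
  exists s, [/\ s =i A, pairwise (relpre Y before) s & size s = #|A|].
Proof.
move=> dis; pose le := relpre (fst \o Y) <=%R.
exists (sort le (enum A)).
split=> [a||]; [by rewrite mem_sort mem_enum | | by rewrite size_sort cardE].
have : pairwise le (sort le (enum A)).
  rewrite -sorted_pairwise; last by move=> y x z; apply: le_trans.
  by apply: sort_sorted => x y; apply: le_total.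
have : pairwise [rel x y | x != y] (sort le (enum A)).
  by rewrite -uniq_pairwise sort_uniq enum_uniq.
move=> u l; have /andP := conj u l; rewrite -pairwise_relI.
apply: (sub_in_pairwise (P := [in A])); last first.
  by rewrite all_sort; apply/allP=> a; rewrite mem_enum.
move=> a b hA hB /andP[/= ab]; rewrite /le /= => lab.
have := dis a b hA hB ab; have := thick lay b; move: lab; clear.
by unfold_ivl; lia.
Qed.

Lemma stack_le4 p s : all (fun a => cell p (X a)) s ->
  pairwise (relpre Y before) s -> (size s <= 4)%N.
Proof.
case: s => [|b1 [|b2 [|b3 [|b4 [|b5 s]]]]] //=.
move=> /and5P[p1 p2 p3 p4 /andP[p5 _]].
move=> /and5P[/and5P[s12 _ _ _ _] /and4P[s23 _ _ _] /and3P[s34 _ _]].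
move=> /andP[s45 _] _.
have ps := introT and5P (And5 p1 p2 p3 p4 p5).
by case: (stack_lt5 lay ps s12 s23 s34 s45).
Qed.
End Split.

Lemma layout_size (T : finType) (X Y : T -> ivl) (x0 x1 y0 y1 : int) :
  #|T| = 7 -> layout X Y ->
  (forall a, x0 <= (X a).1 /\ (X a).2 <= x1) ->
  (forall a, y0 <= (Y a).1 /\ (Y a).2 <= y1) ->
  [/\ 7 <= x1 - x0, 7 <= y1 - y0 & 15 <= (x1 - x0) + (y1 - y0)].
Proof.
move=> T7 lay stripX stripY; have layC := layoutC lay.
have [p disI] := split_column lay.
pose K := [pred a | cell p (X a)]; pose I := [predC K].
have {}disI : {in I &, forall a b, a != b -> ~~ overlap (X a) (X b)} by [].
have disK : {in K &, forall a b, a != b -> ~~ overlap (Y a) (Y b)}.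
  move=> a b; rewrite !inE => pa pb /(one_overlap lay) ->; rewrite negbK.
  by move: pa pb; clear; unfold_ivl; lia.
have [|t tI] := @helly _ Y I.
  move=> a b Ia Ib; have [->|/[dup] ab /(one_overlap lay) ->] := eqVneq a b.
    by have := thick lay b; clear; unfold_ivl; lia.
  exact: disI.
have [s [sK ps zK]] := stack_sort lay disK.
have [r [rI pr zI]] := stack_sort layC disI.
have pS : all (fun a => cell p (X a)) s by apply/allP=> a; rewrite sK.
have tR : all (fun a => cell t (Y a)) r.
  by apply/allP=> a; rewrite rI; apply: tI.
have s4 := stack_le4 lay pS ps; have r4 := stack_le4 layC tR pr.
have sr : (size s + size r = 7)%N by rewrite zK zI cardC.
have ne : {in s & r, forall b c, c != b}.
  by move=> b c; rewrite sK rI => Kb; apply: contraNneq => ->.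
have [[s3 r3]|[s3 r3]] :
    size s = 4%N /\ size r = 3%N \/ size s = 3%N /\ size r = 4%N.
  by move: s4 r4 sr; clear; move: (size s) (size r) => m n; lia.
- move: s r s3 r3 ps pr pS tR ne {sK zK rI zI s4 r4 sr}.
  case=> [|b1 [|b2 [|b3 [|b4 [|//]]]]] // [|c1 [|c2 [|c3 [|//]]]] // _ _ /=.
  move=> /and4P[/and4P[s12 _ _ _] /and3P[s23 _ _] /andP[s34 _] _].
  move=> /and3P[/and3P[r12 _ _] /andP[r23 _] _].
  move=> /and5P[p1 p2 p3 p4 _] /and4P[t1 t2 t3 _] ne.
  have cr : crossing X Y p t b1 b2 b3 b4 c1 c2 c3.
    by split=> //; [exact/andP | exact/and4P | exact/and3P].
  exact: (crossing_size cr stripX stripY).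
(* Four rectangles are side by side: they are a stack for the other axis. *)
move: s r s3 r3 ps pr pS tR ne {sK zK rI zI s4 r4 sr}.
case=> [|c1 [|c2 [|c3 [|//]]]] // [|b1 [|b2 [|b3 [|b4 [|//]]]]] // _ _ /=.
move=> /and3P[/and3P[r12 _ _] /andP[r23 _] _].
move=> /and4P[/and4P[s12 _ _ _] /and3P[s23 _ _] /andP[s34 _] _].
move=> /and4P[t1 t2 t3 _] /and5P[p1 p2 p3 p4 _] ne.
have cr : crossing Y X t p b1 b2 b3 b4 c1 c2 c3.
  split=> //; [exact/andP | exact/and4P | exact/and3P |].
  by move=> b c hb hc; rewrite eq_sym; apply: ne.
by have [h w sum] := crossing_size cr stripY stripX; split=> //; rewrite addrC.
Qed.

(** * Sight in the plane and sight in unit rows and columns *)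

Section Geometry.
Variable R : realType.
Implicit Types (I J K : ivl) (x y : R).

Definition in_open x I := I.1%:~R < x < I.2%:~R.
Definition in_closed x I := I.1%:~R <= x <= I.2%:~R.
Definition half (z : int) : R := z%:~R + 2^-1.

Lemma boxP (u v c d x y : R) :
  box u v c d (x, y) <-> u <= x <= v /\ c <= y <= d.
Proof. by rewrite /box; split=> -[] /=; rewrite !in_itv. Qed.

Lemma rect_setP (A : rect) x y :
  rect_set R A (x, y) <-> in_closed x (val A).1 /\ in_closed y (val A).2.
Proof. exact: boxP. Qed.

Lemma interior_rectP (A : rect) x y :
  interior (rect_set R A) (x, y) <->
  in_open x (val A).1 /\ in_open y (val A).2.
Proof.
pose itv I : set R := `[I.1%:~R, I.2%:~R]%classic.
have itvE I (z : R) : interior (itv I) z <-> in_open z I.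
  by rewrite interior_itv_bnd /in_open /= in_itv.
rewrite -!itvE; split=> [[[P Q] /= [nP nQ] PQ]|[nx ny]]; last first.
  by exists (itv (val A).1, itv (val A).2).
split; [apply: filterS nP | apply: filterS nQ] => z hz.
  by have [] := PQ (z, y) (conj hz (nbhs_singleton nQ)).
by have [] := PQ (x, z) (conj (nbhs_singleton nP) hz).
Qed.

Lemma cell_floor x I : in_open x I -> cell (Num.floor x) I.
Proof.
by case/andP=> l r; rewrite /cell floor_ge_int floor_lt_int r ltW.
Qed.

Lemma floor_in_closed x I : cell (Num.floor x) I -> in_closed x I.
Proof.
by rewrite /cell floor_ge_int floor_lt_int /in_closed => /andP[-> /ltW].
Qed.

Lemma half_in_open z I : cell z I -> in_open (half z) I.
Proof.
rewrite /cell /in_open /half -(ler_int R) => /andP[l].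
by rewrite -lezD1 -(ler_int R) intrD => r; apply/andP; split; lra.
Qed.

Lemma in_closed_half z I : in_closed (half z) I -> cell z I.
Proof.
rewrite /in_closed /cell /half => /andP[l r]; apply/andP; split.
  by rewrite leNgt; apply/negP; rewrite -lezD1 -(ler_int R) intrD; lra.
by rewrite ltNge; apply/negP; rewrite -(ler_int R); lra.
Qed.

Lemma between_in_closed I K J (a b : R) x x' : K.1 < K.2 -> between I K J ->
  in_open x I -> in_open x' J -> a <= x <= b -> a <= x' <= b ->
  exists2 w, a <= w <= b & in_closed w K.
Proof.
rewrite /in_open /in_closed => KK btw /andP[xl xr] /andP[xl' xr'].
move=> /andP[ax xb] /andP[ax' xb'].
have {}KK : K.1%:~R <= K.2%:~R :> R by rewrite ler_int ltW.
exists K.1%:~R; last by rewrite lexx.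
by move: btw KK; rewrite /between /before -!(ler_int R) => /orP[]/andP[] *;
  apply/andP; split; lra.
Qed.

(** The segment realizing a sight from [I] to [J] runs from the midpoint of the
last cell of [I] to the midpoint of the first cell of [J]. *)
Lemma gap_ends I J : before I J -> I.1 < I.2 -> J.1 < J.2 ->
  [/\ half (I.2 - 1) < half J.1, in_open (half (I.2 - 1)) I
    & in_open (half J.1) J].
Proof.
move=> IJ II JJ; split; last 2 first.
- by apply: half_in_open; move: II; clear; unfold_ivl; lia.
- by apply: half_in_open; move: JJ; clear; unfold_ivl; lia.
by rewrite /half ltrD2r ltr_int; move: IJ; clear; unfold_ivl; lia.
Qed.

Lemma gap_clear I J K w : I.1 < I.2 -> J.1 < J.2 -> before I J ->
  ~~ between I K J -> ~~ overlap I K -> ~~ overlap K J ->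
  half (I.2 - 1) <= w <= half J.1 -> ~ in_closed w K.
Proof.
move=> II JJ IJ nb mI mJ wr wK.
have : K.2 <= I.2 - 1 \/ J.1 + 1 <= K.1.
  by move: II JJ IJ nb mI mJ; clear; unfold_ivl; lia.
move: wr wK; rewrite /in_closed /half -!(ler_int R) intrB (intrD _ J.1).
by move=> /andP[? ?] /andP[? ?]; case; lra.
Qed.

Lemma sees_sym S A B : sees R S A B -> sees R S B A.
Proof.
by case=> s [hs sA sB sC]; exists s; split=> // C CS CB CA; apply: sC.
Qed.

Lemma thick_x (A : rect) : (val A).1.1 < (val A).1.2.
Proof. by case/andP: (valP A). Qed.

Lemma thick_y (A : rect) : (val A).2.1 < (val A).2.2.
Proof. by case/andP: (valP A). Qed.

Section Family.
Variables (T : finType) (S : {fset rect}) (r : T -> rect).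
Hypothesis rS : forall A, A \in S <-> exists k, A = r k.
Let X k := (val (r k)).1.
Let Y k := (val (r k)).2.

Lemma between_neq (Z : rect -> ivl) a k b : (forall A, (Z A).1 < (Z A).2) ->
  between (Z (r a)) (Z (r k)) (Z (r b)) -> r k != r a /\ r k != r b.
Proof.
move=> tZ btw; have [ta tb] := (tZ (r a), tZ (r b)).
by split; apply: contraTneq btw => ->; move: ta tb; clear; unfold_ivl; lia.
Qed.

(** The row is the integer part of the height of the segment.  A rectangle that
meets the row contains all heights in it, lower edge included, as it is closed;
so it would block the segment if it were in between. *)
Lemma sees_sight a b :
  sees R S (r a) (r b) -> sight X Y a b \/ sight Y X a b.
Proof.
case=> s [[[u [v [y [uv ->]]]]|[x [u [v [uv ->]]]]]].
- case=> [[xa ya] [/boxP[xar yar] /interior_rectP[xaX yaY]]].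
  case=> [[xb yb] [/boxP[xbr ybr] /interior_rectP[xbX ybY]]] clr.
  move: yar ybr; rewrite -!eq_le => /eqP ya_y /eqP yb_y; subst ya yb.
  left; exists (Num.floor y); split; [exact: cell_floor | exact: cell_floor |].
  move=> k zk; apply/negP=> btw.
  have [w wr wk] := between_in_closed (thick_x (r k)) btw xaX xbX xar xbr.
  have [ka kb] := between_neq (Z := fun A => (val A).1) thick_x btw.
  have : (box u v y y `&` rect_set R (r k)) (w, y).
    split; first by apply/boxP; rewrite lexx.
    by apply/rect_setP; split=> //; apply: floor_in_closed.
  by rewrite clr //; apply/rS; exists k.
case=> [[xa ya] [/boxP[xar yar] /interior_rectP[xaX yaY]]].
case=> [[xb yb] [/boxP[xbr ybr] /interior_rectP[xbX ybY]]] clr.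
move: xar xbr; rewrite -!eq_le => /eqP xa_x /eqP xb_x; subst xa xb.
right; exists (Num.floor x); split; [exact: cell_floor | exact: cell_floor |].
move=> k zk; apply/negP=> btw.
have [w wr wk] := between_in_closed (thick_y (r k)) btw yaY ybY yar ybr.
have [ka kb] := between_neq (Z := fun A => (val A).2) thick_y btw.
have : (box x x u v `&` rect_set R (r k)) (x, w).
  split; first by apply/boxP; rewrite lexx.
  by apply/rect_setP; split=> //; apply: floor_in_closed.
by rewrite clr //; apply/rS; exists k.
Qed.

(** The segment runs along the middle of the row, where it meets only the
rectangles that contain the cell; those which are not in between are kept away
by disjointness. *)
Lemma sight_sees a b :
  (forall c d, c != d -> ~~ (overlap (X c) (X d) && overlap (Y c) (Y d))) ->
  a != b -> sight X Y a b \/ sight Y X a b -> sees R S (r a) (r b).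
Proof.
move=> ap ab.
have apX c d z : c != d -> cell z (Y c) -> cell z (Y d) ->
    ~~ overlap (X c) (X d).
  by move=> /ap; clear; unfold_ivl; lia.
have apY c d z : c != d -> cell z (X c) -> cell z (X d) ->
    ~~ overlap (Y c) (Y d).
  by move=> /ap; clear; unfold_ivl; lia.
have neq k c : r k != r c -> k != c by apply: contraNneq => ->.
have row c d : sight X Y c d -> before (X c) (X d) -> sees R S (r c) (r d).
  case=> z [zc zd zk] bcd.
  have [lt lc rd] := gap_ends bcd (thick_x _) (thick_x _).
  exists (box (half ((X c).2 - 1)) (half (X d).1) (half z) (half z)); split.
  - by left; exists (half ((X c).2 - 1)), (half (X d).1), (half z).
  - exists (half ((X c).2 - 1), half z).
    split; first by apply/boxP; rewrite !lexx ltW.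
    by apply/interior_rectP; split=> //; apply: half_in_open.
  - exists (half (X d).1, half z).
    split; first by apply/boxP; rewrite !lexx ltW.
    by apply/interior_rectP; split=> //; apply: half_in_open.
  move=> C /rS[k ->] /neq kc /neq kd.
  apply/seteqP; split=> // -[x y] [/boxP[xr yr] /rect_setP[wx wy]].
  move: yr wy; rewrite -eq_le => /eqP<- /in_closed_half yk.
  apply: (gap_clear (thick_x _) (thick_x _) bcd (zk k yk) _ _ xr wx).
    by apply: (apX _ _ z) => //; rewrite eq_sym.
  exact: (apX _ _ z).
have col c d : sight Y X c d -> before (Y c) (Y d) -> sees R S (r c) (r d).
  case=> z [zc zd zk] bcd.
  have [lt lc rd] := gap_ends bcd (thick_y _) (thick_y _).
  exists (box (half z) (half z) (half ((Y c).2 - 1)) (half (Y d).1)); split.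
  - by right; exists (half z), (half ((Y c).2 - 1)), (half (Y d).1).
  - exists (half z, half ((Y c).2 - 1)).
    split; first by apply/boxP; rewrite !lexx ltW.
    by apply/interior_rectP; split=> //; apply: half_in_open.
  - exists (half z, half (Y d).1).
    split; first by apply/boxP; rewrite !lexx ltW.
    by apply/interior_rectP; split=> //; apply: half_in_open.
  move=> C /rS[k ->] /neq kc /neq kd.
  apply/seteqP; split=> // -[x y] [/boxP[xr yr] /rect_setP[wx wy]].
  move: xr wx; rewrite -eq_le => /eqP<- /in_closed_half xk.
  apply: (gap_clear (thick_y _) (thick_y _) bcd (zk k xk) _ _ yr wy).
    by apply: (apY _ _ z) => //; rewrite eq_sym.
  exact: (apY _ _ z).
have sight_sym (U V : T -> ivl) : sight U V a b -> sight U V b a.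
  case=> z [za zb zk]; exists z; split=> // k /zk.
  by rewrite /between orbC.
have sep (I J : ivl) : ~~ overlap I J -> before I J \/ before J I.
  by clear; unfold_ivl; lia.
case=> H; have [z [za zb _]] := H.
  have [h|h] := sep _ _ (apX _ _ _ ab za zb); first exact: row.
  by apply: sees_sym; apply: row => //; apply: sight_sym.
have [h|h] := sep _ _ (apY _ _ _ ab za zb); first exact: col.
by apply: sees_sym; apply: col => //; apply: sight_sym.
Qed.

Lemma disjoint_interiorsP : injective r ->
  disjoint_interiors R S <-> forall a b, a != b ->
    ~~ (overlap (X a) (X b) && overlap (Y a) (Y b)).
Proof.
move=> rI; split=> [dis a b ab|ap A B /rS[a ->] /rS[b ->] ab].
  apply/negP=> /andP[mX mY].
  have common (I J : ivl) : I.1 < I.2 -> J.1 < J.2 -> overlap I J ->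
      exists z, cell z I && cell z J.
    by exists (Num.max I.1 J.1); unfold_ivl; lia.
  have [x /andP[xa xb]] := common _ _ (thick_x _) (thick_x _) mX.
  have [y /andP[ya yb]] := common _ _ (thick_y _) (thick_y _) mY.
  have : (interior (rect_set R (r a)) `&` interior (rect_set R (r b)))
      (half x, half y).
    by split; apply/interior_rectP; split; apply: half_in_open.
  by rewrite dis ?(inj_eq rI) //; apply/rS; [exists a | exists b].
apply/seteqP; split=> // -[x y].
move=> [/interior_rectP[xa ya] /interior_rectP[xb yb]].
have {}ab : a != b by move: ab; rewrite (inj_eq rI).
have [ca cb] : cell (Num.floor x) (X a) /\ cell (Num.floor x) (X b).
  by split; apply: cell_floor.
have [da db] : cell (Num.floor y) (Y a) /\ cell (Num.floor y) (Y b).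
  by split; apply: cell_floor.
suff: False by [].
by have := ap a b ab; move: ca cb da db; clear; unfold_ivl; lia.
Qed.
End Family.

(** * The lower bounds *)

Lemma complete_layout n (S : {fset rect}) (f : complete_graph n -> S) :
  disjoint_interiors R S -> bijective f ->
  (forall u v : complete_graph n, u != v ->
     adj u v <-> sees R S (val (f u)) (val (f v))) ->
  layout (fun k => (val (val (f k))).1) (fun k => (val (val (f k))).2).
Proof.
move=> dis fB fA; pose r k := val (f k).
have rS A : A \in S <-> exists k, A = r k.
  split=> [AS|[k ->]]; last exact: valP.
  by have [g _ fK] := fB; exists (g [` AS]%fset); rewrite /r fK.
have rI : injective r by move=> a b /val_inj/(bij_inj fB).
split.
- by move=> a; split; [apply: thick_x | apply: thick_y].
- exact/(disjoint_interiorsP rS rI).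
by move=> a b ab; apply: (sees_sight rS); apply/fA.
Qed.

Lemma rect_sub (A B : rect) : rect_set R A `<=` rect_set R B ->
  ((val B).1.1 <= (val A).1.1 /\ (val A).1.2 <= (val B).1.2) /\
  ((val B).2.1 <= (val A).2.1 /\ (val A).2.2 <= (val B).2.2).
Proof.
move=> AB; have /andP[tx ty] := valP A.
have /AB/rect_setP[] : rect_set R A ((val A).1.1%:~R, (val A).2.1%:~R).
  by apply/rect_setP; rewrite /in_closed !lexx !ler_int !ltW.
have /AB/rect_setP[] : rect_set R A ((val A).1.2%:~R, (val A).2.2%:~R).
  by apply/rect_setP; rewrite /in_closed !lexx !ler_int !ltW.
rewrite /in_closed !ler_int.
by move=> /andP[_ ->] /andP[_ ->] /andP[-> _] /andP[-> _].
Qed.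

Lemma K7_size (S : {fset rect}) (B : rect) :
  RV_representation R (complete_graph 7) S -> bounding_box R S B ->
  [/\ 7 <= rect_width B, 7 <= rect_height B
    & 15 <= rect_width B + rect_height B].
Proof.
move=> [dis [f [fB fA]]] [sub _].
have lay := complete_layout dis fB fA.
have inB k := rect_sub (sub _ (valP (f k))).
apply: (layout_size (card_ord 7) lay) => k; first by have [] := inB k.
by have [_] := inB k.
Qed.
End Geometry.

(** * A representation in a box of width 7 and height 8 *)

(** The first three rectangles are the [c]'s, the other four the [b]'s.  The
arrangement realizes equality in the bounds: in a box of width 7, the [c]'s
have width 1 and [b2] and [b3] have height 2, and the rows [3] and [6], where
[c1] sees [c2] and [c3], avoid the [b]'s. *)
Definition K7_rects : seq (ivl * ivl) :=
  [:: ((0, 1), (0, 8)); ((5, 6), (2, 5)); ((6, 7), (1, 8));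
      ((2, 7), (0, 1)); ((1, 3), (1, 3)); ((2, 4), (4, 6)); ((1, 6), (7, 8))].

Definition K7_coords (k : nat) : ivl * ivl := nth ((0, 1), (0, 1)) K7_rects k.
Definition K7_x k := (K7_coords k).1.
Definition K7_y k := (K7_coords k).2.

Definition sightb (U V : nat -> ivl) (i j : nat) : bool :=
  has (fun z : nat => [&& cell z%:Z (V i), cell z%:Z (V j) &
    all (fun k => cell z%:Z (V k) ==> ~~ between (U i) (U k) (U j)) (iota 0 7)])
    (iota 0 8).

Lemma K7_check : all (fun i => is_rect (K7_coords i) && all (fun j =>
  (i == j) || ~~ (overlap (K7_x i) (K7_x j) && overlap (K7_y i) (K7_y j)) &&
    (sightb K7_x K7_y i j || sightb K7_y K7_x i j)) (iota 0 7)) (iota 0 7).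
Proof. by vm_compute. Qed.

Lemma sightbP (U V : nat -> ivl) (i j : 'I_7) : sightb U V i j ->
  sight (fun k : 'I_7 => U k) (fun k : 'I_7 => V k) i j.
Proof.
case/hasP=> z _ /and3P[zi zj /allP zk]; exists z%:Z; split=> // k.
by apply/implyP/zk; rewrite mem_iota ltn_ord.
Qed.

Lemma K7_pair (i j : 'I_7) : i != j ->
  ~~ (overlap (K7_x i) (K7_x j) && overlap (K7_y i) (K7_y j)) /\
  (sightb K7_x K7_y i j || sightb K7_y K7_x i j).
Proof.
have m (k : 'I_7) : (k : nat) \in iota 0 7 by rewrite mem_iota ltn_ord.
move=> /negPf ij.
have /allP/(_ i (m i))/andP[_ /allP/(_ j (m j))] := K7_check.
by rewrite (inj_eq val_inj) ij => /andP.
Qed.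

Lemma K7_is_rect (i : 'I_7) : is_rect (K7_coords i).
Proof.
by have /allP/(_ i) := K7_check; rewrite mem_iota ltn_ord => /(_ isT)/andP[].
Qed.

Definition K7_rect (i : 'I_7) : rect := exist _ (K7_coords i) (K7_is_rect i).

Lemma K7_rect_inj : injective K7_rect.
Proof.
move=> i j eij; apply/eqP/negPn/negP=> /K7_pair[].
have -> : K7_x i = K7_x j by have := congr1 (fun A => (val A).1) eij.
have -> : K7_y i = K7_y j by have := congr1 (fun A => (val A).2) eij.
have [] : (K7_x j).1 < (K7_x j).2 /\ (K7_y j).1 < (K7_y j).2.
  exact/andP/K7_is_rect.
by rewrite /overlap; clear; lia.
Qed.

Definition K7_set : {fset rect} := [fset K7_rect i | i in 'I_7]%fset.

Lemma K7_setP A : A \in K7_set <-> exists k, A = K7_rect k.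
Proof.
split=> [/imfsetP[k _ ->]|[k ->]]; first by exists k.
exact: in_imfset.
Qed.

Definition K7_box : rect := exist _ ((0, 7), (0, 8)) isT.

Lemma K7_RV (R : realType) : RV_representation R (complete_graph 7) K7_set.
Proof.
have ap (c d : 'I_7) : c != d -> _ := fun cd => (K7_pair cd).1.
split; first exact/(disjoint_interiorsP R K7_setP K7_rect_inj).
exists (fun i => [` (K7_setP (K7_rect i)).2 (ex_intro _ i erefl)]%fset); split.
  apply: inj_card_bij; first by move=> i j /(congr1 val)/K7_rect_inj.
  by rewrite -cardfE card_imfset ?cardE //; exact: K7_rect_inj.
move=> i j ij; split=> // _; apply: (sight_sees R K7_setP ap ij).
by case/orP: (K7_pair ij).2 => /sightbP; [left|right].
Qed.

Lemma K7_bounding_box (R : realType) : bounding_box R K7_set K7_box.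
Proof.
split=> [A /K7_setP[i ->]|a b c d inbox].
  have /allP/(_ i) : all (fun k => [&& 0 <= (K7_x k).1, (K7_x k).2 <= 7,
      0 <= (K7_y k).1 & (K7_y k).2 <= 8]) (iota 0 7) by [].
  rewrite mem_iota ltn_ord -!(ler_int R) => /(_ isT)/and4P[x0 x7 y0 y8].
  move=> -[x y] /rect_setP[/andP[lx rx] /andP[ly ry]]; apply/rect_setP.
  by split; apply/andP; split; [apply: le_trans lx | apply: le_trans rx _ |
    apply: le_trans ly | apply: le_trans ry _].
have corner (i : 'I_7) (x y : int) : (K7_x i).1 <= x <= (K7_x i).2 ->
    (K7_y i).1 <= y <= (K7_y i).2 -> a <= x%:~R <= b /\ c <= y%:~R <= d.
  move=> xi yi; have /inbox H : K7_rect i \in K7_set by apply/K7_setP; exists i.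
  apply/boxP; apply: (H (x%:~R, y%:~R)).
  by apply/rect_setP; rewrite /in_closed !ler_int.
have [/andP[a0 _] /andP[c0 _]] := corner (@Ordinal 7 0 isT) 0 0 isT isT.
have [_ /andP[_ d8]] := corner (@Ordinal 7 0 isT) 0 8 isT isT.
have [/andP[_ b7] _] := corner (@Ordinal 7 2 isT) 7 1 isT isT.
move=> [x y] /rect_setP[/andP[lx rx] /andP[ly ry]]; apply/boxP.
by rewrite (le_trans a0 lx) (le_trans rx b7) (le_trans c0 ly) (le_trans ry d8).
Qed.

Theorem corollary6p8 (R : realType) :
  is_area R (complete_graph 7) 56 /\ is_perim R (complete_graph 7) 30.
Proof.
have attained : [set B | exists S, RV_representation R (complete_graph 7) S /\
    bounding_box R S B] K7_box.
  by exists K7_set; split; [apply: K7_RV | apply: K7_bounding_box].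
split; split.
- by exists K7_box.
- move=> _ [B [S [RS SB]] <-]; have [w h s] := K7_size RS SB.
  by rewrite /rect_area; move: w h s; clear; nia.
- by exists K7_box.
move=> _ [B [S [RS SB]] <-]; have [w h s] := K7_size RS SB.
by rewrite /rect_perim; move: s; clear; lia.
Qed.
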